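(* Let $G$ be an amenable, compactly generated, locally compact group, and let $\mu$ be a courteous probability measure on $G$. If $\dim \mathsf{HF}_1(G,\mu)<\infty$, then every $h\in\mathsf{HF}_1(G,\mu)$ which is positive must be constant.
   Context: Let $G$ be a compactly generated locally compact group, and fix a compact symmetric generating set $K=K^{-1}$. Let $|x|=\min\{n : x\in K^n\}$ be the word length with respect to $K$ (with $|1|=0$). None of the notions below depends on the choice of $K$. A probability measure $\mu$ on $G$ is courteous if it is adapted (there is no proper closed subgroup $H\lneq G$ with $\mu(H)=1$), symmetric ($\mu(A)=\mu(A^{-1})$ for every measurable $A$), and has a third moment ($\int_G |s|^3\,d\mu(s)<\infty$). A function $f:G\to\mathbb R$ is $\mu$-harmonic if $f(x)=\int_G f(xs)\,d\mu(s)$ for all $x\in G$. The space $\mathsf{HF}_1(G,\mu)$ is the real vector space of continuous $\mu$-harmonic functions $f:G\to\mathbb R$ of linear growth, i.e. with $\limsup_{r\to\infty} r^{-1}\sup_{|x|\le r}|f(x)|<\infty$. *)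

(* Defs.v *)
From HB Require Import structures.
From mathcomp Require Import all_boot all_order all_algebra.
From mathcomp Require Import all_classical all_reals all_analysis.

Set Implicit Arguments.
Unset Strict Implicit.
Unset Printing Implicit Defensive.

Import Order.TTheory GRing.Theory Num.Theory.
Import numFieldNormedType.Exports.

Local Open Scope classical_set_scope.
Local Open Scope ring_scope.

HB.mixin Record isTopologicalGroup G & Topological G & Group G := {
  mulg_continuous : continuous (fun xy : G * G => (xy.1 * xy.2)%g : G) ;
  invg_continuous : continuous (fun x : G => x^-1%g : G) ;
}.

(* The base point required by measurable types is arbitrary; it plays no role
   and need not be 1. *)
#[short(type="topologicalGroupType")]
HB.structure Definition TopologicalGroup :=
  {G of PointedTopological G & Group G & isTopologicalGroup G}.

Definition borel (T : ptopologicalType) := g_sigma_algebraType (@open T).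

Section finite_dimension.
Context {R : fieldType} {V : lmodType R}.

Definition finite_dimensional (A : set V) : Prop :=
  exists (n : nat) (b : 'I_n -> V), (forall i, A (b i)) /\
    (forall v, A v -> exists c : 'I_n -> R, v = \sum_(i < n) c i *: b i).

End finite_dimension.

Section word_length.
Context {G : groupType}.
Implicit Type K : set G.

Fixpoint setpow K (n : nat) : set G :=
  if n is m.+1 then [set (x * y)%g | x in K & y in setpow K m]
  else [set 1%g].

(* Junk value 0 outside of the union of the powers of K. *)
Definition word_length K (x : G) : nat :=
  if pselect (exists n, `[< setpow K n x >]) is left ex then ex_minn ex else 0.

End word_length.

(* Since K is symmetric, the subgroup it generates is the union of the K^n. *)
Definition compact_symmetric_generating (G : topologicalGroupType)
    (K : set G) : Prop :=
  [/\ compact K, [set x^-1%g | x in K] = K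
    & \bigcup_n setpow K n = [set: G]].

Section amenability.
Variables (R : realType) (G : topologicalGroupType).

Definition bounded_continuous (f : G -> R) : Prop :=
  continuous f /\ exists M, forall x, `|f x| <= M.

(* Existence of a left-invariant mean on the bounded continuous functions; for
   locally compact groups this is equivalent to the existence of one on
   L^oo(G). Values of m outside of the bounded continuous functions are
   irrelevant. *)
Definition amenable : Prop := exists m : (G -> R) -> R,
  [/\ forall (a : R) (f g : G -> R), bounded_continuous f ->
        bounded_continuous g -> m (a *: f + g) = a * m f + m g,
      forall f : G -> R, bounded_continuous f ->
        (forall x, 0 <= f x) -> 0 <= m f,
      m (cst 1) = 1
    & forall (g : G) (f : G -> R), bounded_continuous f ->
        m (fun x => f (g * x)%g) = m f].

End amenability.

Section harmonic_functions.
Context {R : realType} {G : topologicalGroupType}.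
Variables (K : set G) (mu : probability (borel G) R).

Definition adapted : Prop :=
  ~ exists H : set G,
      [/\ closed H, group_closed (mem H), H != [set: G] & mu H = 1%E].

Definition symmetric_measure : Prop :=
  forall A : set (borel G), measurable A ->
    mu A = mu [set (x : G)^-1%g | x in A].

Definition third_moment : Prop :=
  (\int[mu]_s ((word_length K s)%:R ^+ 3)%:E < +oo)%E.

Definition courteous : Prop :=
  [/\ adapted, symmetric_measure & third_moment].

Definition harmonic (f : G -> R) : Prop :=
  forall x : G,
    mu.-integrable [set: borel G] (fun s => (f (x * s)%g)%:E) /\
    (f x)%:E = (\int[mu]_s (f (x * s)%g)%:E)%E.

Definition sup_on_ball (f : G -> R) (r : nat) : \bar R :=
  ereal_sup [set `|f x|%:E | x in [set x | (word_length K x <= r)%N]].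

Definition linear_growth (f : G -> R) : Prop :=
  (limn_esup (fun r : nat => (r%:R^-1)%:E * sup_on_ball f r) < +oo)%E.

Definition HF1 : set (G -> R) :=
  [set f | [/\ continuous f, harmonic f & linear_growth f]].

End harmonic_functions.

(* Main.v *)
(* Subtract from h its infimum c, so that h' = h - c is nonnegative and takes
   arbitrarily small values. By finite dimensionality and the maximum principle,
   {f : f >= 0, f(1) = 1} is compact in the span of the left translates of h',
   so h'(x .) is small in that span as soon as h'(x) is. Hence some translate is
   h'(x .) = sum_i c_i h'(y_i .) with sum_i |c_i| <= 1/4, and iterating this
   identity gives |h'(z)| <= 4^-n C (|z| + n L + 1) for all n, whence h' = 0. *)
Require Import Defs.
From mathcomp Require Import all_boot all_order all_algebra.
From mathcomp Require Import all_classical all_reals all_analysis.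
From mathcomp Require Import zify.
Import numFieldNormedType.Exports.
Local Open Scope classical_set_scope.
Local Open Scope ring_scope.

Set Implicit Arguments.
Unset Strict Implicit.
Unset Printing Implicit Defensive.

Import Order.TTheory GRing.Theory Num.Theory.

(** * Linear algebra: function spaces and evaluation matrices *)

(** Eliminating the lower left block leaves the Schur complement of [A] as last pivot, nonzero by
    the second hypothesis. *)
Lemma unitmx_block (F : fieldType) (k : nat) (A : 'M[F]_k) (u : 'cV[F]_k)
    (v : 'rV[F]_k) (s : F) :
  A \in unitmx -> s != (v *m invmx A *m u) 0 0 ->
  block_mx A u v s%:M \in unitmx.
Proof.
move=> uA sN; rewrite unitmxE.
have : \det (block_mx 1%:M 0 (- (v *m invmx A)) 1%:M *m block_mx A u v s%:M)
    \is a GRing.unit.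
  rewrite mulmx_block !mul1mx !mul0mx !addr0 !mulNmx mulmxKV // addNr.
  rewrite det_ublock unitrM -unitmxE uA /= det_mx11 addrC mxE.
  by rewrite [_%:M _ _]mxE eqxx mulr1n [X in s + X]mxE unitfE subr_eq0.
by rewrite det_mulmx det_lblock !det1 !mul1r.
Qed.

(* The number of rows of an invertible matrix of values [f i (z j)] is at most
   the dimension of the spanning family; at a maximal one, the Schur complement
   of every one-step extension vanishes, which expresses any other function. *)
Lemma basis_of_functions (F : fieldType) (X : Type) (n : nat)
    (b : 'I_n -> X -> F) (P : set (X -> F)) :
    (forall f, P f -> exists c : 'I_n -> F,
      forall x, f x = \sum_(i < n) c i * b i x) ->
  exists (k : nat) (f : 'I_k -> X -> F) (z : 'I_k -> X),
    [/\ forall i, P (f i), (\matrix_(i, j) f i (z j)) \in unitmx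
      & forall g, P g -> exists c : 'rV[F]_k,
          forall x, g x = \sum_(i < k) c 0 i * f i x].
Proof.
move=> Pb.
pose Q k := `[< exists (f : 'I_k -> X -> F) (z : 'I_k -> X),
  (forall i, P (f i)) /\ (\matrix_(i, j) f i (z j)) \in unitmx >].
have exQ : exists k, Q k.
  exists 0; apply/asboolP.
  exists (fun=> fun=> 0), (fun i : 'I_0 => False_rect X (notF (ltn_ord i))).
  by split=> [[]//|]; rewrite unitmxE det_mx00 unitr1.
have ubQ k : Q k -> (k <= n)%N.
  move=> /asboolP[f [z [Pf]]]; rewrite -row_full_unit => /eqP <-.
  have [c cE] : {c : 'I_k -> 'I_n -> F |
      forall i x, f i x = \sum_(j < n) c i j * b j x}.
    exists (fun i => projT1 (cid (Pb _ (Pf i)))) => i x.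
    by case: cid.
  (* Expanding each [f i] in [b] factors the matrix through dimension [n], so its rank [k] is at
     most [n]. *)
  rewrite (_ : \matrix_(i, j) _ =
      (\matrix_(i, j) c i j) *m (\matrix_(i, j) b i (z j))).
    exact: mulmx_max_rank.
  apply/matrixP => i j; rewrite !mxE cE.
  by apply: eq_bigr => l _; rewrite !mxE.
case: (ex_maxnP exQ ubQ) => k /asboolP[f [z [Pf uA]]] kmax.
exists k, f, z; split=> // g Pg.
set A := matrix_of_fun _ _ in uA.
(* The values of [g] at the points [z j] leave only [v *m invmx A] as coefficients. Were they wrong
   at some [x], adjoining [g] and [x] would contradict the maximality of [k]. *)
pose v := \row_j g (z j).
exists (v *m invmx A) => x.
pose u := \col_i f i x.
have -> : \sum_(i < k) (v *m invmx A) 0 i * f i x = (v *m invmx A *m u) 0 0.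
  by rewrite [RHS]mxE; apply: eq_bigr => i _; rewrite [u _ _]mxE.
apply/eqP; apply: contraT => /(unitmx_block uA) uB.
suff /kmax : Q (k + 1)%N by rewrite addn1 ltnn.
apply/asboolP.
exists (fun i : 'I_(k + 1) => if fintype.split i is inl j then f j else g).
exists (fun i : 'I_(k + 1) => if fintype.split i is inl j then z j else x).
split=> [i|]; first by case: fintype.split.
rewrite (_ : \matrix_(i, j) _ = block_mx A u v (g x)%:M) //.
apply/matrixP => i j; rewrite !mxE.
case: (fintype.split i) => i'; rewrite !mxE; case: (fintype.split j) => j'; rewrite !mxE //.
by rewrite !ord1 eqxx mulr1n.
Qed.

(** * Word length and linear growth *)

Section word_length_theory.
Context {G : topologicalGroupType} (K : set G).
Hypothesis genK : compact_symmetric_generating K.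

Lemma setpowM (m n : nat) (x y : G) :
  setpow K m x -> setpow K n y -> setpow K (m + n) (x * y)%g.
Proof.
elim: m x => [|m IH] x; first by move=> -> ?; rewrite mul1g.
move=> [a Ka [b Kb <-]] Ky; rewrite addSn; exists a => //.
by exists (b * y)%g; [exact: IH | rewrite mulgA].
Qed.

Lemma setpow_word_length (x : G) : setpow K (word_length K x) x.
Proof.
rewrite /word_length; case: pselect => [ex|[]].
  by case: ex_minnP => m /asboolP.
have [_ _ gen] := genK.
have [n _ Kn] : (\bigcup_n setpow K n) x by rewrite gen.
by exists n; apply/asboolP.
Qed.

Lemma word_length_le (n : nat) (x : G) :
  setpow K n x -> (word_length K x <= n)%N.
Proof.
rewrite /word_length => Kn; case: pselect => // ex.
by case: ex_minnP => m _; apply; apply/asboolP.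
Qed.

Lemma word_lengthM (x y : G) :
  (word_length K (x * y)%g <= word_length K x + word_length K y)%N.
Proof. by apply/word_length_le/setpowM; exact: setpow_word_length. Qed.

End word_length_theory.

Lemma linear_growthP (R : realType) (G : topologicalGroupType) (K : set G)
    (f : G -> R) :
  linear_growth K f <->
  exists2 C : R, 0 <= C & forall x, `|f x| <= C * (word_length K x).+1%:R.
Proof.
split=> [|[C C0 fC]].
  move=> /ereal_inf_lt[_ [V [N _ NV] <-]] supV.
  set S := ereal_sup _ in supV.
  have [D D0 SD] : exists2 D : R, 0 <= D & (S <= D%:E)%E.
    case: (S) supV => [r _|//|_]; last by exists 0 => //; rewrite leNye.
    by exists `|r|; rewrite ?lee_fin ?ler_norm.
  exists (D * N.+1%:R) => [|x]; first by rewrite mulr_ge0.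
  (* A positive radius, large enough for the limsup bound, whose ball contains [x], and at most
     [(N + 1) * (|x| + 1)]. *)
  pose n := (N + (word_length K x).+1)%N.
  have n0 : 0 < n%:R :> R by rewrite /n addnS.
  have : ((n%:R^-1)%:E * `|f x|%:E <= D%:E)%E.
    apply: le_trans SD; apply: (@le_trans _ _ ((n%:R^-1)%:E * sup_on_ball K f n)%E).
      apply: lee_wpmul2l; first by rewrite lee_fin invr_ge0 ltW.
      by apply: ereal_sup_ubound; exists x; rewrite //= /n addnS ltnW// ltnS leq_addl.
    by apply: ereal_sup_ubound; exists n => //; apply: NV => /=; rewrite leq_addr.
  rewrite -EFinM lee_fin mulrC ler_pdivrMr// => /le_trans; apply.
  rewrite -mulrA ler_wpM2l// -natrM ler_nat /n; nia.
apply: (@le_lt_trans _ _ (C *+ 2)%:E); last by rewrite ltry.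
rewrite /limn_esup /limf_esup.
apply: (@le_trans _ _ (ereal_sup [set ((r%:R^-1)%:E * sup_on_ball K f r)%E | r in [set: nat]])).
  by apply: ereal_inf_lbound; exists setT => //; exact: filterT.
apply: ge_ereal_sup => _ [n _ <-].
have supC : (sup_on_ball K f n <= (C * n.+1%:R)%:E)%E.
  apply: ge_ereal_sup => _ [x /= xn <-]; rewrite lee_fin (le_trans (fC x))//.
  by rewrite ler_wpM2l// ler_nat ltnS.
(* At radius 0 the term vanishes since [0^-1 = 0]; otherwise [(n + 2) / (n + 1) <= 2] explains the
   bound [C *+ 2]. *)
case: n supC => [|n] supC; first by rewrite invr0 mul0e lee_fin mulrn_wge0.
apply: (@le_trans _ _ ((n.+1%:R^-1)%:E * (C * n.+2%:R)%:E)%E).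
  by apply: lee_wpmul2l => //; rewrite lee_fin invr_ge0.
rewrite -EFinM lee_fin mulrC ler_pdivrMr// -[C *+ 2]mulr_natr -mulrA ler_wpM2l//.
by rewrite -natrM ler_nat mul2n -addnn addSnnS leq_addl.
Qed.

(** * [HF1] as a vector space invariant under left translation *)

Section harmonic_theory.
Context {R : realType} {G : topologicalGroupType}.
Variables (K : set G) (mu : probability (borel G) R).
Hypothesis genK : compact_symmetric_generating K.

Lemma harmonic_cst (c : R) : Defs.harmonic mu (cst c : G -> R).
Proof.
move=> x; split; first exact: finite_measure_integrable_cst.
rewrite (integral_cst mu measurableT c%:E).
by rewrite [X in (_ * X)%E](probability_setT mu) mule1.
Qed.

Lemma harmonic_lin (a : R) (f g : G -> R) :
  Defs.harmonic mu f -> Defs.harmonic mu g ->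
  Defs.harmonic mu (fun x => a * f x + g x).
Proof.
move=> hf hg x; have [If fE] := hf x; have [Ig gE] := hg x.
have Iaf := integrableZl measurableT a If.
split; first exact: (integrableD measurableT Iaf Ig).
rewrite EFinD EFinM fE gE -integralZl// -integralD//.
Qed.

(** Averaging multiplies on the right, hence commutes with left translation. *)
Lemma harmonic_translate (y : G) (f : G -> R) :
  Defs.harmonic mu f -> Defs.harmonic mu (fun x => f (y * x)%g).
Proof.
move=> hf x; have [If fE] := hf (y * x)%g.
by split; [move: If | rewrite fE]; under eq_fun do rewrite -mulgA.
Qed.

Lemma continuous_translate (y : G) (f : G -> R) :
  continuous f -> continuous (fun x => f (y * x)%g).
Proof.
move=> cf x.
apply: (@continuous_comp _ _ _ (fun x => y * x)%g f); last exact: cf.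
apply: (@continuous_comp _ _ _ (fun x => (y, x)) (fun xy : G * G => xy.1 * xy.2)%g).
  by apply: cvg_pair => /=; [exact: cvg_cst | exact: cvg_id].
exact: mulg_continuous.
Qed.

Lemma HF1_cst (c : R) : HF1 K mu (cst c : G -> R).
Proof.
split; [by move=> ?; exact: cvg_cst | exact: harmonic_cst |].
apply/linear_growthP; exists `|c| => // x.
by rewrite ler_peMr// ler1n.
Qed.

Lemma HF1_lin (a : R) (f g : G -> R) :
  HF1 K mu f -> HF1 K mu g -> HF1 K mu (fun x => a * f x + g x).
Proof.
move=> [cf hf /linear_growthP[C C0 fC]] [cg hg /linear_growthP[D D0 gD]].
split; last 1 first.
- apply/linear_growthP; exists (`|a| * C + D) => [|x].
    by rewrite addr_ge0// mulr_ge0.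
  rewrite (le_trans (ler_normD _ _))// mulrDl lerD// normrM -mulrA.
  by rewrite ler_wpM2l.
- move=> x; apply: cvgD; last exact: cg.
  by apply: cvgM; [exact: cvg_cst | exact: cf].
- exact: harmonic_lin.
Qed.

Lemma HF1_sum (k : nat) (c : 'I_k -> R) (f : 'I_k -> G -> R) :
  (forall i, HF1 K mu (f i)) -> HF1 K mu (fun x => \sum_(i < k) c i * f i x).
Proof.
move=> Hf; elim: k c f Hf => [|k IH] c f Hf.
  by under eq_fun do rewrite big_ord0; exact: HF1_cst.
by under eq_fun do rewrite big_ord_recl; apply: HF1_lin => //; exact: IH.
Qed.

Lemma HF1_translate (y : G) (f : G -> R) :
  HF1 K mu f -> HF1 K mu (fun x => f (y * x)%g).
Proof.
move=> [cf hf /linear_growthP[C C0 fC]]; split.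
- exact: continuous_translate.
- exact: harmonic_translate.
- apply/linear_growthP; exists (C * (word_length K y).+1%:R) => [|x].
    by rewrite mulr_ge0.
  rewrite (le_trans (fC _))// -mulrA ler_wpM2l// -natrM ler_nat.
  by have := word_lengthM genK y x; nia.
Qed.

End harmonic_theory.

(** * The maximum principle *)

Section maximum_principle.
Context {R : realType} {G : topologicalGroupType}.
Variables (K : set G) (mu : probability (borel G) R).
Hypothesis genK : compact_symmetric_generating K.
Hypothesis adapted_mu : adapted mu.
Hypothesis symmetric_mu : symmetric_measure mu.
Hypothesis finite_dim_HF1 : finite_dimensional (HF1 K mu).

Lemma HF1_spanned : exists (n : nat) (b : 'I_n -> G -> R),
  forall f, HF1 K mu f -> exists c : 'I_n -> R,
    forall x, f x = \sum_(i < n) c i * b i x.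
Proof.
have [n [b [_ bspan]]] := finite_dim_HF1.
exists n, b => f /bspan[c ->]; exists c => x.
by rewrite fct_sumE.
Qed.

Lemma closed_measurable (A : set G) :
  closed A -> measurable (A : set (borel G)).
Proof.
move=> cA; rewrite -[A]setCK; apply: measurableC.
by apply: sub_sigma_algebra; exact: closed_openC.
Qed.

(** By harmonicity at 1 the integral of [f] is [f 1 = 0], and a nonnegative function with zero
    integral vanishes almost everywhere. *)
Lemma nonneg_harmonic_null (f : G -> R) :
    continuous f -> Defs.harmonic mu f -> (forall x, 0 <= f x) -> f 1%g = 0 ->
  mu (~` [set x | f x = 0]) = 0%E.
Proof.
move=> cf hf f0 f1; have [+ fE] := hf 1%g.
under eq_fun do rewrite mul1g.
move=> /integrableP[mf _].
have /(ae_eq_integral_abs mu measurableT mf) : (\int[mu]_s `|(f s)%:E|)%E = 0%E.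
  transitivity (f 1%g)%:E; last by rewrite f1.
  rewrite fE; apply: eq_integral => s _.
  by rewrite mul1g gee0_abs// lee_fin.
move=> fae; apply: measure_negligible.
  apply: measurableC; apply: closed_measurable.
  apply: (@preimage_closed _ _ f [set 0]); last exact: closed_eq.
  by move=> x _; exact: cf.
apply: negligibleS fae => x /= fx H.
by apply: fx; have [] := H I.
Qed.

(* Almost sureness only passes to countable intersections, so one function must
   carry the argument: [F] sums finitely many functions spanning those that are
   nonnegative, harmonic and zero at 1, hence its zeros are their common zeros,
   which are stable under product. *)
Lemma nonneg_HF1_eq0 (f : G -> R) :
  HF1 K mu f -> (forall x, 0 <= f x) -> f 1%g = 0 -> forall x, f x = 0.
Proof.
move=> Hf f0 f1.
pose P := [set u : G -> R | [/\ HF1 K mu u, forall x, 0 <= u x & u 1%g = 0]].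
have [n [b bspan]] := HF1_spanned.
have [|k [u [z [Pu _ uspan]]]] := @basis_of_functions _ _ n b P.
  by move=> g [/bspan].
pose F x := \sum_(i < k) 1 * u i x.
have F0 x : 0 <= F x.
  by apply: sumr_ge0 => i _; rewrite mul1r; have [] := Pu i.
have F1 : F 1%g = 0.
  by rewrite /F big1// => i _; have [_ _ ->] := Pu i; rewrite mulr0.
have HF : HF1 K mu F by apply: HF1_sum => // i; have [] := Pu i.
have FP g x : P g -> F x = 0 -> g x = 0.
  move=> /uspan[c ->] /eqP; rewrite psumr_eq0 => [/allP Fx|i _]; last first.
    by rewrite mul1r; have [] := Pu i.
  rewrite big1// => i _; have := Fx i; rewrite mem_index_enum mul1r.
  by move=> /(_ isT)/eqP->; rewrite mulr0.
(* When [F x = 0], the translate [F (x * _)] vanishes at 1, hence lies in [P] and vanishes wherever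
   [F] does. *)
have FM x y : F x = 0 -> F y = 0 -> F (x * y)%g = 0.
  move=> Fx Fy; apply: (FP (fun y => F (x * y)%g)) => //; split=> //.
    exact: HF1_translate.
  by rewrite mulg1.
have [cF hF _] := HF.
(* [A] is only a closed submonoid; intersecting it with its inverse [B] gives a closed subgroup.
   Symmetry of [mu] gives [B] full measure too, so by adaptedness the subgroup is all of [G]. *)
pose A := [set x | F x = 0]; pose B := [set x | F x^-1%g = 0].
have cA : closed A.
  apply: (@preimage_closed _ _ F [set 0]); last exact: closed_eq.
  by move=> x _; exact: cF.
have cB : closed B.
  apply: (@preimage_closed _ _ (fun x => x^-1%g) A) => //.
  by move=> x _; exact: invg_continuous.
have BE : B = [set x^-1%g | x in A].
  apply/seteqP; split=> [x Bx|_ [x Ax <-]]; last by rewrite /B /= invgK.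
  by exists x^-1%g; rewrite ?invgK.
have mA : mu (~` A) = 0%E by exact: nonneg_harmonic_null.
have mB : mu (~` B) = 0%E.
  rewrite probability_setC; last exact: closed_measurable.
  rewrite BE -symmetric_mu; last exact: closed_measurable.
  by rewrite -probability_setC//; exact: closed_measurable.
have mAB : mu (A `&` B) = 1%E.
  have mmAB : measurable (A `&` B : set (borel G)).
    by apply: closed_measurable; exact: closedI.
  have mC0 : mu (~` (A `&` B)) = 0%E.
    rewrite setCI; apply: measure_negligible.
      by apply: measurableU; apply: measurableC; exact: closed_measurable.
    apply: negligibleU; apply/negligibleP => //;
      by apply: measurableC; exact: closed_measurable.
  by rewrite -[A `&` B]setCK probability_setC ?mC0 ?sube0//; exact: measurableC.
have [ABT|ABN] := eqVneq (A `&` B) [set: G].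
  move=> x; apply: FP => //.
  by have [] : (A `&` B) x by rewrite ABT.
case: adapted_mu; exists (A `&` B); split=> //; first exact: closedI.
split=> [|x y]; rewrite !inE; first by rewrite /A /B /= invg1.
move=> [Ax Bx] [Ay By]; split; first exact: FM.
by rewrite /B /= invgM invgK; exact: FM.
Qed.

End maximum_principle.

(** * Contracting identities between translates *)

Section decay.
Context {R : realType} {G : topologicalGroupType}.
Variables (K : set G) (mu : probability (borel G) R).
Hypothesis genK : compact_symmetric_generating K.

(** Each use of the identity gains a factor 4 and lengthens the argument by at most a fixed [L];
    linear growth cannot make up for the exponential gain. *)
Lemma linear_growth_eq0 (h : G -> R) (x : G) (k : nat) (y : 'I_k -> G)
    (c : 'I_k -> R) :
    linear_growth K h ->
    (forall w, h (x * w)%g = \sum_(i < k) c i * h (y i * w)%g) ->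
    \sum_(i < k) `|c i| <= 4^-1 ->
  forall z, h z = 0.
Proof.
move=> /linear_growthP[C C0 hC] hx c4 z.
have [L yL] : exists L, forall i, (word_length K (y i * x^-1)%g <= L)%N.
  exists (\max_(i < k) word_length K (y i * x^-1)%g)%N => i.
  exact: leq_bigmax.
have main n w : `|h w| * 4 ^+ n <= C * (word_length K w + n * L).+1%:R.
  elim: n w => [|n IH] w; first by rewrite expr0 mulr1 mul0n addn0.
  rewrite -[w in h w](mulVKg x) hx.
  set B := C * _.
  have hB i : `|h (y i * (x^-1 * w))%g| * 4 ^+ n <= B.
    apply: le_trans (IH _) _; rewrite ler_wpM2l// ler_nat mulgA mulSn.
    rewrite ltnS addnA leq_add2r (leq_trans (word_lengthM genK _ _))//.
    by rewrite addnC leq_add2l.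
  have B0 : 0 <= B by rewrite mulr_ge0.
  rewrite exprS [X in _ * X]mulrC mulrA -ler_pdivlMr//.
  apply: (@le_trans _ _ (\sum_(i < k) `|c i| * B)).
    rewrite (le_trans (ler_wpM2r _ (ler_norm_sum _ _ _)))// ?exprn_ge0//.
    rewrite mulr_suml ler_sum// => i _.
    by rewrite normrM -mulrA ler_wpM2l.
  by rewrite -mulr_suml [X in _ <= X]mulrC ler_wpM2r.
apply/eqP; rewrite -normr_eq0; apply: contraT => hz0.
have hz : 0 < `|h z| by rewrite lt_def hz0 normr_ge0.
pose D := C * (word_length K z + L).+1%:R.
(* Chosen so that [D < |h z| * (n + 1)]. The bound [main] at [n + 1] gives the opposite inequality
   after multiplication by [2 ^ (n + 1)], as [n + 1 < 2 ^ (n + 1)]. *)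
pose n := Num.truncn (D / `|h z|).
have : D < `|h z| * n.+1%:R.
  by rewrite mulrC -ltr_pdivrMr// truncnS_gt.
rewrite ltNge => /negP[].
rewrite -(ler_pM2r (exprn_gt0 n.+1 (ltr0n R 2))) -mulrA.
apply: (@le_trans _ _ (`|h z| * 4 ^+ n.+1)).
  rewrite ler_wpM2l//; rewrite -!natrX -natrM ler_nat.
  by rewrite (expnMn 2 2) leq_mul2r ltnW ?orbT// ltn_expl.
rewrite (le_trans (main _ _))// /D -mulrA ler_wpM2l// -natrX -natrM ler_nat.
have := ltn_expl n.+1 (isT : 1 < 2)%N; nia.
Qed.

Hypothesis adapted_mu : adapted mu.
Hypothesis symmetric_mu : symmetric_measure mu.
Hypothesis finite_dim_HF1 : finite_dimensional (HF1 K mu).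

(* The nonnegative combinations of a basis of translates form a closed cone of
   a finite-dimensional space, and evaluation at 1 is positive on it except at
   its apex; a translate of [h] with a small value at 1 is hence small. *)
Lemma small_translate (h : G -> R) (e : R) :
    HF1 K mu h -> (forall x, 0 <= h x) ->
    (forall d, 0 < d -> exists x, h x <= d) -> 0 < e ->
  exists (x : G) (k : nat) (y : 'I_k -> G) (c : 'I_k -> R),
    (forall w, h (x * w)%g = \sum_(i < k) c i * h (y i * w)%g) /\
    \sum_(i < k) `|c i| <= e.
Proof.
move=> Hh h0 infh e0.
have [n [b bspan]] := HF1_spanned finite_dim_HF1.
pose P := [set u : G -> R | exists y, u = fun w => h (y * w)%g].
have PH u : P u -> HF1 K mu u by move=> [y ->]; exact: HF1_translate.
have [|k [f [z [Pf uf fspan]]]] := @basis_of_functions _ _ n b P.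
  by move=> u /PH/bspan.
have [y fE] : {y : 'I_k -> G | forall i, f i = fun w => h (y i * w)%g}.
  by exists (fun i => projT1 (cid (Pf i))) => i; case: cid.
pose L (v : 'rV[R]_k) x := \sum_(i < k) v 0 i * f i x.
have cL x : continuous (L^~ x).
  apply: continuous_big => [|i _]; first exact: add_continuous.
  move=> v; apply: (@continuous_comp _ _ _ (fun u : 'rV[R]_k => u 0 i)
    (fun t => t * f i x)); [exact: coord_continuous | exact: mulrr_continuous].
(* The slice of norm 1 of the cone of coefficients of nonnegative functions. *)
pose D := [set v : 'rV[R]_k | `|v| = 1 /\ forall x, 0 <= L v x].
have compactD : compact D.
  apply: bounded_closed_compact.
    by exists 1; split; [exact: num_real | move=> M M1 v [v1 _] /=]; rewrite v1 ltW.
  rewrite (_ : D = (fun v => `|v|) @^-1` [set 1] `&`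
      \bigcap_(x in [set: G]) (L^~ x @^-1` [set t | 0 <= t])).
    apply: closedI.
      apply: preimage_closed => [v _|]; last exact: closed_eq.
      exact: norm_continuous.
    apply: closed_bigI => x _.
    by apply: preimage_closed => [v _|]; [exact: cL | exact: closed_ge].
  by apply/seteqP; split=> v [v1 Lv]; split=> // x; [move=> _; exact: Lv | exact: Lv].
have Dgt0 v : D v -> 0 < L v 1%g.
  move=> [v1 Lv]; rewrite lt_def Lv andbT; apply/negP => /eqP Lv1.
  have HLv : HF1 K mu (L v).
    by apply: (HF1_sum (v 0)) => i; exact: PH.
  have Lv0 := nonneg_HF1_eq0 genK adapted_mu symmetric_mu finite_dim_HF1
    HLv Lv Lv1.
  suff v0 : v = 0 by move: v1; rewrite v0 normr0 => /esym/eqP; rewrite oner_eq0.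
  (* The values of [L v] at the points [z j] determine [v], because the evaluation matrix is
     invertible. *)
  rewrite -[v](mulmxK uf) (_ : v *m _ = 0) ?mul0mx//.
  apply/rowP => j; rewrite !mxE -[RHS](Lv0 (z j)).
  by apply: eq_bigr => i _; rewrite mxE.
have [m m0 Dm] : exists2 m, 0 < m & forall v, D v -> m <= L v 1%g.
  have [D0|D0] := pselect (D !=set0); last first.
    by exists 1 => // v Dv; case: D0; exists v.
  have [v /set_mem Dv vmin] :=
    EVT_min_rV D0 compactD (continuous_subspaceT (cL 1%g)).
  by exists (L v 1%g) => [|w Dw]; [exact: Dgt0 | exact/vmin/mem_set].
(* Homogeneity extends the bound from the slice to the whole cone. *)
have Lm v : (forall x, 0 <= L v x) -> m * `|v| <= L v 1%g.
  move=> Lv; have [vE|v0] := eqVneq v 0.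
    by rewrite [in _ * _]vE normr0 mulr0 Lv.
  have nv0 : 0 < `|v| by rewrite normr_gt0.
  have LZ x : L (`|v|^-1 *: v) x = L v x / `|v|.
    rewrite /L mulr_suml; apply: eq_bigr => i _.
    by rewrite mxE [RHS]mulrC mulrA.
  rewrite -ler_pdivlMr// -LZ; apply: Dm; split.
    by rewrite normrZ normfV normr_id mulVf// gt_eqF.
  by move=> x; rewrite LZ divr_ge0.
(* The sum of the [|c i|] is at most [k] times the sup norm of [c]; dividing by [k + 1] also covers
   [k = 0]. *)
have [x hx] := infh (m * (e / k.+1%:R)) ltac:(by rewrite mulr_gt0// divr_gt0).
have [c cE] := fspan (fun w => h (x * w)%g) (ex_intro _ x erefl).
exists x, k, y, (c 0); split=> [w|].
  by rewrite cE; apply: eq_bigr => i _; rewrite fE.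
have : m * `|c| <= m * (e / k.+1%:R).
  by rewrite (le_trans (Lm c _))// => [w|]; rewrite /L -cE ?mulg1.
rewrite ler_pM2l// ler_pdivlMr// => /(le_trans _); apply.
apply: (@le_trans _ _ (\sum_(i < k) `|c|)).
  apply: ler_sum => i _.
  rewrite /Num.norm /= mx_normrE.
  exact: (le_bigmax _ (fun ij => `|c ij.1 ij.2|) (0, i)).
by rewrite sumr_const card_ord -[_ *+ k]mulr_natr ler_wpM2l// ler_nat.
Qed.

End decay.

(** * Positive functions in [HF1] are constant *)

Theorem theorem6 (R : realType) (G : topologicalGroupType) (K : set G)
    (mu : probability (borel G) R)
    (hausdorffG : hausdorff_space G)
    (locally_compactG : locally_compact [set: G])
    (generatingK : compact_symmetric_generating K)
    (amenableG : amenable R G)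
    (courteous_mu : courteous K mu)
    (finite_dim_HF1 : finite_dimensional (HF1 K mu))
    (h : G -> R) (HF1h : HF1 K mu h) (positive_h : forall x, 0 < h x) :
  exists c : R, h = cst c.
Proof.
have [adapted_mu symmetric_mu _] := courteous_mu.
have infh : has_inf (range h).
  by split; [exists (h 1%g), 1%g | exists 0 => _ [x _ <-]; exact: ltW].
pose c := inf (range h); exists c.
(* The factor 1 matches the form of [HF1_lin]. Membership in [HF1] is kept because constants belong
   to it. *)
pose h' x := 1 * h x + cst (- c) x.
have Hh' : HF1 K mu h' by apply: HF1_lin => //; exact: HF1_cst.
have h'E x : h' x = h x - c by rewrite /h' mul1r.
have [|d d0||x [k [y [a [hx a4]]]]] :=
    @small_translate _ _ _ _ generatingK adapted_mu symmetric_mu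
      finite_dim_HF1 h' 4^-1 Hh'.
- by move=> x; rewrite h'E subr_ge0; apply: ge_inf; [case: infh | exists x].
- have [_ [x _ <-] hx] := inf_adherent d0 infh.
  by exists x; rewrite h'E lerBlDl ltW.
- by rewrite invr_gt0.
have [_ _ lh'] := Hh'.
apply/funext => w; apply/eqP; rewrite -subr_eq0 -h'E; apply/eqP.
exact: linear_growth_eq0 lh' hx a4 w.
Qed.
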